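(* Let $G$ be an Abelian group, $X$ a topological space with $|X|\ge 2$, and $f\colon G\to X$ a Korovin mapping. If the Korovin orbit $G_f\subset X^G$ is infinite and pseudocompact, then $G_f$ is not homeomorphic to (the underlying space of) any topological group.
   Context: Let $(G,+)$ be an Abelian group and $X$ a topological space with at least two elements. The group $G$ (carrying no topology) acts on the set $X^G$ of all maps $G\to X$ by $s\colon G\times X^G\to X^G$, $s(g,f)(h)=f(g+h)$ for $f\in X^G$, $g,h\in G$. An element $f\in X^G$ is called a Korovin mapping if for every $M\subset G$ with $|M|\leq\omega$ and every $h\in X^M$ there exists $g\in G$ such that $h=s(g,f)|_M$. For a Korovin mapping $f$, the Korovin orbit is the subspace $G_f=\{s(g,f): g\in G\}$ of $X^G$, where $X^G$ has the product topology. A space is pseudocompact if it is Tychonoff (completely regular and Hausdorff) and every continuous real-valued function on it is bounded. *)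

(* Defs.v *)
From HB Require Import structures.
From mathcomp Require Import all_boot all_order all_algebra.
From mathcomp Require Import all_classical all_reals all_analysis.

Set Implicit Arguments.
Unset Strict Implicit.
Unset Printing Implicit Defensive.

Import Order.TTheory GRing.Theory Num.Theory.
Import numFieldNormedType.Exports.

Local Open Scope classical_set_scope.
Local Open Scope ring_scope.

(* The library only has commutative (additive) topological groups.  Groups are
   multiplicative here, possibly non-commutative, and no separation axiom is
   imposed on the topology. *)
HB.mixin Record isTopologicalGroup G & Topological G & Group G := {
  mulg_continuous : continuous (fun xy : G * G => (xy.1 * xy.2)%g) ;
  invg_continuous : continuous (fun x : G => x^-1%g)
}.

#[short(type="topologicalGroupType")]
HB.structure Definition TopologicalGroup :=
  {G of Topological G & Group G & isTopologicalGroup G}.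

Definition homeomorphic (S T : topologicalType) : Prop :=
  exists (u : S -> T) (v : T -> S),
    [/\ continuous u, continuous v, cancel u v & cancel v u].

Definition tychonoff_space (T : topologicalType) : Prop :=
  completely_regular_space T /\ hausdorff_space T.

Definition pseudocompact (R : realType) (T : topologicalType) : Prop :=
  tychonoff_space T /\
  forall g : T -> R, continuous g -> [bounded g x | x in [set: T]].

Section Korovin.
Variables (G : zmodType) (X : topologicalType).

Definition translation (g : G) (f : G -> X) : G -> X := fun h => f (g + h).

Definition korovin_mapping (f : G -> X) : Prop :=
  forall M : set G, countable M ->
  forall h : M -> X, exists g : G, h = sigL M (translation g f).

(* [{ptws G -> X}] is [G -> X] with the product topology; coerced to a type,
   the orbit carries the subspace topology. *)
Definition korovin_orbit (f : G -> X) : set {ptws G -> X} :=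
  [set translation g f | g in [set: G]].

End Korovin.

(* Main.v *)
Require Import Defs.
From mathcomp Require Import all_boot all_order all_algebra.
From mathcomp Require Import all_classical all_reals all_analysis.

(** Commutativity of [G] makes a Korovin mapping work in the dual direction:
    if a countable set of orbit points is written as the translates of [f] by
    the elements of a countable [M], then evaluation at a suitable coordinate
    [k], which sends the translate by [g] to [f (g + k)] = [f (k + g)], takes
    arbitrarily prescribed values on these points.  Since [X] is not indiscrete
    (otherwise the orbit would be indiscrete, hence not Hausdorff), coordinates
    isolate any point of any countable subset of the orbit: every countable
    subset of the orbit is discrete ([korovin_orbit_countable_discrete]).

    A pseudocompact topological group is precompact
    ([pseudocompact_group_precompact]): otherwise some neighbourhood [U] of [1]
    and some sequence [t] satisfy [(t m)^-1 * t n \notin U] for [m <> n], so the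
    translates of a small neighbourhood [V] of [1] by the [t n] form a discrete
    family, which carries an unbounded continuous function.

    The two properties clash in an infinite group.  For an injective sequence
    [t], the countable set of all the [(t m)^-1 * t n] contains [1].  If this
    set were discrete, some neighbourhood of [1] would contain
    [(t m)^-1 * t n] only when [m = n], contrary to precompactness. *)

Set Implicit Arguments.
Unset Strict Implicit.
Unset Printing Implicit Defensive.

Import Order.TTheory GRing.Theory Num.Theory.
Import numFieldNormedType.Exports.

Local Open Scope classical_set_scope.
Local Open Scope ring_scope.

(** * Homeomorphism invariance of pseudocompactness *)

Lemma homeomorphic_completely_regular (R : realType) (S T : topologicalType) :
  homeomorphic S T -> completely_regular_space S -> completely_regular_space T.
Proof.
move=> [u [v [uc vc uK vK]]] crS a B clB nBa.
have clB' : closed (u @^-1` B) by apply: closed_comp => // x _; exact: uc.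
have nBva : ~ (u @^-1` B) (v a) by rewrite /= vK.
have /(uniform_separatorP (R := R))[p [pc p01 p0 p1]] := crS _ _ clB' nBva.
apply/(uniform_separatorP (R := R)); exists (p \o v); split.
- by move=> x; apply: continuous_comp; [exact: vc|exact: pc].
- by move=> _ [x _ <-]; apply: p01; exists (v x).
- by move=> _ [_ -> <-]; apply: p0; exists (v a).
- by move=> _ [x Bx <-]; apply: p1; exists (v x) => //=; rewrite vK.
Qed.

Lemma homeomorphic_hausdorff (S T : topologicalType) :
  homeomorphic S T -> hausdorff_space S -> hausdorff_space T.
Proof.
move=> [u [v [uc vc uK vK]]] hS x y xy; apply: (can_inj vK); apply: hS.
move=> A B /(vc x) Ax /(vc y) By.
by have [z [Az Bz]] := xy _ _ Ax By; exists (v z).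
Qed.

Lemma homeomorphic_pseudocompact (R : realType) (S T : topologicalType) :
  homeomorphic S T -> pseudocompact R S -> pseudocompact R T.
Proof.
move=> ST [[crS hS] bS]; split.
  split; first exact: (@homeomorphic_completely_regular R _ _ ST).
  exact: homeomorphic_hausdorff ST hS.
have [u [v [uc vc uK vK]]] := ST.
move=> g gc; have /bS[M [Mr Mb]] : continuous (g \o u).
  by move=> x; apply: continuous_comp; [exact: uc|exact: gc].
by exists M; split => // r Mlr x _ /=; rewrite -(vK x); exact: (Mb r Mlr (v x)).
Qed.

(** * Pseudocompact topological groups are precompact *)

Section TopologicalGroup.
Variable T : topologicalGroupType.
Local Open Scope group_scope.

Lemma continuous_lmulg (a : T) : continuous (fun x : T => a * x).
Proof.
move=> x.
apply: (@cvg_comp _ _ _ (fun y : T => (a, y)) (fun p : T * T => p.1 * p.2)).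
  by apply: (@cvg_pair _ _ _ _ (nbhs a) (nbhs x));
    [exact: cvg_cst|exact: cvg_id].
exact: (mulg_continuous (a, x)).
Qed.

Lemma nbhs1_divg (U : set T) : nbhs 1 U ->
  exists2 V : set T, nbhs 1 V & forall a b, V a -> V b -> U (a * b^-1).
Proof.
move=> U1.
have : (fun p : T * T => p.1 * p.2^-1) @ ((1, 1) : T * T) --> (1 * 1^-1 : T).
  apply: (@cvg_comp _ _ _ (fun p : T * T => (p.1, p.2^-1))
           (fun p : T * T => p.1 * p.2)); last exact: (mulg_continuous (1, 1^-1)).
  apply: (@cvg_pair _ _ _ _ (nbhs 1) (nbhs 1^-1)); first exact: cvg_fst.
  by apply: (@cvg_comp _ _ _ snd (fun x : T => x^-1));
    [exact: cvg_snd|exact: (invg_continuous 1)].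
rewrite invg1 mulg1 => /(_ _ U1)[[A B] [/= A1 B1] AB].
exists (A `&` B); first exact: filterI.
by move=> a b [Aa _] [_ Bb]; exact: (AB (a, b)).
Qed.

(** The four-fold quotient is what makes the translates of [V] by a
    [U]-separated family discrete: [x V] meets two such translates only if
    they are equal. *)
Lemma nbhs1_separated_discrete (I : Type) (t : I -> T) (U : set T) :
  nbhs 1 U -> (forall i j, U ((t i)^-1 * t j) -> i = j) ->
  exists2 V : set T, nbhs 1 V & forall x y z i j,
    V (x^-1 * y) -> V (x^-1 * z) ->
    V ((t i)^-1 * y) -> V ((t j)^-1 * z) -> i = j.
Proof.
move=> /nbhs1_divg[W /nbhs1_divg[V V1 VW] WU] tU.
exists V => // x y z i j Vxy Vxz Viy Vjz; apply: tU.
have := WU _ _ (VW _ _ Viy Vxy) (VW _ _ Vjz Vxz).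
by rewrite !invgM !invgK !mulgA !(mulgK, mulgVK).
Qed.

(** The unbounded function is the sum over [n] of [n] times a bump at [t n]
    supported in [t n V]; discreteness of the family of translates makes it
    locally a multiple of a single bump. *)
Lemma pseudocompact_group_precompact (R : realType) (t : nat -> T) (U : set T) :
  pseudocompact R T -> nbhs 1 U ->
  ~ (forall m n, U ((t m)^-1 * t n) -> m = n).
Proof.
move=> [[crT _] bT] U1 tU.
have [V V1 Vt] := nbhs1_separated_discrete U1 tU.
have [p [pc _ p0 p1]] : exists p : T -> R, [/\ continuous p,
    range p `<=` `[0%R, 1%R], p @` [set 1] `<=` [set 0%R] &
    p @` (~` V^°) `<=` [set 1%R]].
  apply/uniform_separatorP; apply: crT; first exact: open_closedC (open_interior V).
  by apply; exact: V1.
(* The separating function is 0 at 1 and 1 off V; a bump is its complement. *)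
pose q (x : T) : R := (1 - p x)%R.
have qc : continuous q by move=> x; apply: cvgB; [exact: cvg_cst|exact: pc].
have q1 : q 1 = 1%R by rewrite /q (_ : p 1 = 0%R) ?subr0//; apply: p0; exists 1.
have q0 x : ~ V x -> q x = 0%R.
  move=> nVx; rewrite /q (_ : p x = 1%R) ?subrr//; apply: p1.
  by exists x => // /interior_subset.
(* If [x] lies in no [t n * V], then [idx x] is the default value [0] and
   [F x] vanishes because of the factor [0%:R]. *)
pose idx (x : T) : nat := xget 0%N [set n | V ((t n)^-1 * x)].
pose F (x : T) : R := ((idx x)%:R * q ((t (idx x))^-1 * x)%g)%R.
(* On the neighbourhood [x V] of [x] at most the [n0 x]-th bump is nonzero. *)
have /choice[n0 n0P] : forall x : T, exists n : nat, forall y m,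
    V (x^-1 * y) -> V ((t m)^-1 * y) -> m = n.
  move=> x; have [[n [z [Vxz Vnz]]]|no] :=
      pselect (exists n z, V (x^-1 * z) /\ V ((t n)^-1 * z)).
    by exists n => y m Vxy Vmy; exact: (Vt x y z).
  by exists 0%N => y m Vxy Vmy; case: no; exists m, y.
have FE x y : V (x^-1 * y) -> F y = ((n0 x)%:R * q ((t (n0 x))^-1 * y)%g)%R.
  move=> Vxy; rewrite /F /idx; case: xgetP => [m _ Vmy|no].
    by rewrite (n0P x y m).
  by rewrite mul0r q0 ?mulr0//; exact: no.
have Fc : continuous F.
  move=> x; have nx : nbhs x [set y | V (x^-1 * y)].
    by apply: (continuous_lmulg (a := x^-1)); rewrite mulVg.
  rewrite /continuous_at (FE x x); last first.
    by rewrite mulVg; exact: nbhs_singleton V1.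
  have loc : {near x, (fun y => (n0 x)%:R * q ((t (n0 x))^-1 * y)%g)%R =1 F}.
    by apply: filterS nx => y /FE ->.
  apply: cvg_trans (near_eq_cvg loc) _; apply: cvgM; first exact: cvg_cst.
  apply: (@continuous_comp _ _ _ (fun y : T => (t (n0 x))^-1 * y) q).
    exact: continuous_lmulg.
  exact: qc.
have Ft n : F (t n) = n%:R%R.
  have Vn : V ((t n)^-1 * t n) by rewrite mulVg; exact: nbhs_singleton V1.
  rewrite (FE (t n) (t n)) // -(n0P (t n) (t n) n) // mulVg q1 mulr1 //.
have [M [Mr Mb]] := bT F Fc.
have /(Mb _) /(_ (t (Num.bound (`|M| + 1)%R)) I) /= : (M < M + 1)%R by rewrite ltrDl.
apply/negP; rewrite -ltNge Ft normr_nat.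
apply: le_lt_trans (archi_boundP _); first by rewrite lerD2r ler_norm.
by rewrite addr_ge0.
Qed.

(** It suffices to consider the set of all quotients of an injective sequence,
    at the point [1]. *)
Lemma infinite_pseudocompact_group_countable_nondiscrete (R : realType) :
  pseudocompact R T -> infinite_set [set: T] ->
  ~ (forall (S : set T) (x : T), countable S -> S x ->
     exists2 U : set T, nbhs x U & forall y, S y -> U y -> y = x).
Proof.
move=> pT /infiniteP /card_leP[t'] disc.
pose t n : T := val (t' (to_setT n)).
have t_inj m n : t m = t n -> m = n.
  by move/val_inj/(@inj _ _ _ t'); rewrite !inE => /(_ I I)/(congr1 val).
pose S := range (fun mn : nat * nat => (t mn.1)^-1 * t mn.2).
have [||U U1 SU] := disc S 1.
- exact: sub_countable (card_image_le _ _) (countableP _).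
- by exists (0%N, 0%N) => //=; rewrite mulVg.
apply: (pseudocompact_group_precompact pT U1) => m n Umn; apply: t_inj.
have /SU/(_ Umn) tmn : S ((t m)^-1 * t n) by exists (m, n).
by rewrite -(mulVKg (t m) (t n)) tmn mulg1.
Qed.

End TopologicalGroup.

(** * Countable subsets of a Korovin orbit *)

Section KorovinOrbit.
Variables (G : zmodType) (X : topologicalType) (f : G -> X).
Implicit Types z : korovin_orbit f.

Lemma continuous_orbit_eval (k : G) :
  continuous (fun z : korovin_orbit f => set_val z k).
Proof.
move=> z.
apply: (@cvg_comp _ _ _ set_val (fun w : {ptws G -> X} => w k)).
  exact: initial_continuous.
exact: (@proj_continuous G (fun=> X) k).
Qed.

(** If [X] is indiscrete, so is its power [{ptws G -> X}], and so is the
    orbit. *)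
Lemma hausdorff_orbit_not_indiscrete :
  infinite_set (korovin_orbit f) -> hausdorff_space (korovin_orbit f) ->
  exists x y : X, exists2 W : set X, open W & W x /\ ~ W y.
Proof.
move=> finf hf; apply: contra_notP finf => indisc.
have eqz z w : z = w.
  apply: hf => A B [/= _ [[C oC <-] /= Cz] CA] Bw; exists w.
  split; last exact: nbhs_singleton.
  (* In an indiscrete product, everything converges to every point. *)
  have zw : globally [set (set_val w : {ptws G -> X})] -->
      (set_val z : {ptws G -> X}).
    apply/cvg_sup => i D [/= _ [[E oE <-] /= Ez] ED] _ ->; apply: ED => /=.
    apply: contrapT => nEw; apply: indisc.
    by exists (set_val z i), (set_val w i), E.
  by apply: CA; apply: (zw C) => //; exact: open_nbhs_nbhs.
have f0 : korovin_orbit f (translation 0 f) by exists 0.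
apply: sub_finite_set (finite_set1 (translation 0 f)) => w fw.
by have /(congr1 set_val) := eqz (SigSub (mem_set fw))
  (SigSub (mem_set f0)).
Qed.

(** The isolating neighbourhood of [z] consists of the points whose [k]-th
    coordinate lies in [W]; the Korovin property provides a [k] at which [z]
    has coordinate [x] and every other point of [S] has coordinate [y]. *)
Lemma korovin_orbit_countable_discrete (S : set (korovin_orbit f)) z :
  korovin_mapping f ->
  (exists x y : X, exists2 W : set X, open W & W x /\ ~ W y) ->
  countable S -> S z ->
  exists2 U : set (korovin_orbit f), nbhs z U &
    forall w, S w -> U w -> w = z.
Proof.
move=> kf [x [y [W oW [Wx nWy]]]] cS Sz.
have /choice[g gE] : forall w : korovin_orbit f,
    exists a : G, translation a f = set_val w.
  by move=> w; have [a _ aE] := set_valP w; exists a.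
pose M := g @` S.
have cM : countable M by exact: sub_countable (card_image_le _ _) cS.
have [k kE] := kf M cM (fun m => if val m == g z then x else y).
have fk w : S w -> set_val w k = if g w == g z then x else y.
  move=> Sw; have Mw : M (g w) by exists w.
  have /= := congr1 (fun e => e (SigSub (mem_set Mw))) kE.
  (* Commutativity exchanges the translation [k] and the coordinate [g w]. *)
  by rewrite -gE /translation addrC => <-.
exists [set w | W (set_val w k)].
  apply: continuous_orbit_eval; apply: open_nbhs_nbhs; split => //.
  by rewrite fk ?eqxx.
move=> w Sw /=; rewrite fk//.
case: eqP => // gwz _; apply: val_inj => /=.
by rewrite -[LHS]gE gwz gE.
Qed.

End KorovinOrbit.

Theorem corollary1 (R : realType) (G : zmodType) (X : topologicalType)
    (f : G -> X) (hX : exists x y : X, x <> y) (hf : korovin_mapping f)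
    (hinf : infinite_set (korovin_orbit f))
    (hpc : pseudocompact R (korovin_orbit f)) :
  forall T : topologicalGroupType, ~ homeomorphic (korovin_orbit f) T.
Proof.
move=> T fT; have [u [v [uc vc uK vK]]] := fT.
have pT := homeomorphic_pseudocompact fT hpc.
have hT : infinite_set [set: T].
  apply: contra_not hinf => finT.
  rewrite (_ : korovin_orbit f = range (set_val \o v)).
    exact: finite_image.
  apply/seteqP; split => [w fw|_ [x _ <-]]; last exact: set_valP.
  by exists (u (SigSub (mem_set fw))) => //=; rewrite uK.
apply: (infinite_pseudocompact_group_countable_nondiscrete pT hT) => S x cS Sx.
have [||U Ux SU] := korovin_orbit_countable_discrete (S := v @` S) (z := v x) hf
  (hausdorff_orbit_not_indiscrete hinf hpc.1.2).
- exact: sub_countable (card_image_le _ _) cS.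
- by exists x.
exists (v @^-1` U); first exact: vc.
by move=> y Sy Uvy; apply: (can_inj vK); apply: SU => //; exists y.
Qed.
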